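(* Let $g\colon\mathbb{R}^n\to\mathbb{R}\cup\{+\infty\}$ be a lower semicontinuous function and let $S:=\{x\in\mathbb{R}^n : g(x)\le0\}$. Assume that $S$ has an error bound at infinity, i.e., there exist $\alpha>0$ and $R>0$ such that $d(x;S)\le\alpha[g(x)]_+$ for all $x\in\mathbb{R}^n$ with $\|x\|>R$. Then $$N(\infty;S)\subset\bigcup\{\lambda\circ\partial g(\infty) : \lambda\ge0\}.$$ If in addition $g$ is Lipschitz at infinity, then $$N(\infty;S)\subset\bigcup\{\lambda\,\partial g(\infty) : \lambda\ge0\}.$$
   Context: $\mathbb{R}^n$ carries the Euclidean norm; $d(x;S):=\inf\{\|y-x\| : y\in S\}$; $[t]_+:=\max\{t,0\}$; $\mathrm{dom}\,g:=\{x : g(x)<+\infty\}$; $\mathrm{epi}\,g:=\{(x,\alpha)\in\mathbb{R}^n\times\mathbb{R} : \alpha\ge g(x)\}$. The function $g$ is Lipschitz at infinity if there exist $L>0$ and $R>0$ such that $g$ is finite on $\mathbb{R}^n\setminus\mathbb{B}_R$ and $|g(x)-g(x')|\le L\|x-x'\|$ for all $x,x'\in\mathbb{R}^n\setminus\mathbb{B}_R$, where $\mathbb{B}_R$ is the closed ball of radius $R$ centered at $0$. Normal cones. For $C\subset\mathbb{R}^d$ and $\bar x\in C$, the Fréchet normal cone is $\widehat N(\bar x;C):=\{v\in\mathbb{R}^d : \limsup_{x\to\bar x,\,x\in C}\langle v,x-\bar x\rangle/\|x-\bar x\|\le 0\}$. The limiting normal cone $N(\bar x;C)$ is the set of all $v$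 for which there exist $x_k\in C$, $x_k\to\bar x$, and $v_k\in\widehat N(x_k;C)$ with $v_k\to v$. Normal cone at infinity. For a closed $S\subset\mathbb{R}^n$, $N(\infty;S)$ is the set of all $v$ for which there exist $x_k\in S$ with $\|x_k\|\to\infty$ and $v_k\in\widehat N(x_k;S)$ with $v_k\to v$. (The notion is meant for unbounded $S$; for bounded $S$ this formula gives the empty set.) Subdifferentials at infinity. For a lower semicontinuous $g\colon\mathbb{R}^n\to\mathbb{R}\cup\{+\infty\}$ (the notion is meant for $g$ with unbounded domain), let $\mathcal{N}$ be the set of all $w\in\mathbb{R}^n\times\mathbb{R}$ for which there exist $x_k\in\mathrm{dom}\,g$ with $\|x_k\|\to\infty$ and $w_k\in N((x_k,g(x_k));\mathrm{epi}\,g)$ with $w_k\to w$. Then $\partial g(\infty):=\{u : (u,-1)\in\mathcal{N}\}$ and $\partial^\infty g(\infty):=\{u : (u,0)\in\mathcal{N}\}$. For $\lambda\ge0$: $\lambda\circ\partial g(\infty):=\lambda\,\partial g(\infty)$ if $\lambda>0$, and $0\circ\partial g(\infty):=\partial^\infty g(\infty)$. *)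

(* Defs.v *)
From mathcomp Require Import all_boot all_order all_algebra.
From mathcomp Require Import all_classical all_reals all_analysis.
Import Order.TTheory GRing.Theory Num.Theory.
Import numFieldNormedType.Exports.

Set Implicit Arguments.
Unset Strict Implicit.
Unset Printing Implicit Defensive.

Local Open Scope classical_set_scope.
Local Open Scope ring_scope.

(* The library norm `|x| on 'rV[R]_n is the sup norm.  Wherever a norm or a
   distance matters, the Euclidean norm enorm below is used instead; the
   library topology on 'rV[R]_n is also the one induced by enorm. *)

Definition dot (R : realType) (n : nat) (u v : 'rV[R]_n) : R :=
  \sum_(i < n) u 0 i * v 0 i.

Definition enorm (R : realType) (n : nat) (x : 'rV[R]_n) : R :=
  Num.sqrt (dot x x).

(* Extended-real valued, so that the distance to the empty set is +oo. *)
Definition edistance (R : realType) (n : nat) (x : 'rV[R]_n)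
    (S : set 'rV[R]_n) : \bar R :=
  ereal_inf [set (enorm (y - x))%:E | y in S].

Definition edom (R : realType) (n : nat) (g : 'rV[R]_n -> \bar R) :
    set 'rV[R]_n :=
  [set x | (g x < +oo)%E].

Definition sublevel0 (R : realType) (n : nat) (g : 'rV[R]_n -> \bar R) :
    set 'rV[R]_n :=
  [set x | (g x <= 0)%E].

(* R^n x R is identified with R^(n+1), the last coordinate being the real
   component; dot and enorm on 'rV[R]_(n + 1) are then the Euclidean structure
   of the product. *)
Definition epair (R : realType) (n : nat) (x : 'rV[R]_n) (a : R) :
    'rV[R]_(n + 1) :=
  row_mx x (const_mx a).

Definition epigraph (R : realType) (n : nat) (g : 'rV[R]_n -> \bar R) :
    set 'rV[R]_(n + 1) :=
  [set z | exists x a, (g x <= a%:E)%E /\ z = epair x a].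

(* The limsup is over punctured neighbourhoods of xbar in C; at an isolated
   point of C it is -oo, so every v is then a normal. *)
Definition frechet_normal (R : realType) (d : nat) (xbar : 'rV[R]_d)
    (C : set 'rV[R]_d) : set 'rV[R]_d :=
  [set v | (limf_esup (fun x : 'rV[R]_d =>
                         (dot v (x - xbar) / enorm (x - xbar))%:E)
              (within C xbar^') <= 0)%E].

Definition limiting_normal (R : realType) (d : nat) (xbar : 'rV[R]_d)
    (C : set 'rV[R]_d) : set 'rV[R]_d :=
  [set v | exists x_ v_ : nat -> 'rV[R]_d,
     [/\ forall k, C (x_ k),
         x_ k @[k --> \oo] --> xbar,
         forall k, frechet_normal (x_ k) C (v_ k)
       & v_ k @[k --> \oo] --> v]].

Definition normal_at_infinity (R : realType) (n : nat) (S : set 'rV[R]_n) :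
    set 'rV[R]_n :=
  [set v | exists x_ v_ : nat -> 'rV[R]_n,
     [/\ forall k, S (x_ k),
         enorm (x_ k) @[k --> \oo] --> +oo,
         forall k, frechet_normal (x_ k) S (v_ k)
       & v_ k @[k --> \oo] --> v]].

(* The use of fine is harmless for g : R^n -> R u {+oo}, as x_ k ranges over
   dom g, where g is finite. *)
Definition epi_normal_at_infinity (R : realType) (n : nat)
    (g : 'rV[R]_n -> \bar R) : set 'rV[R]_(n + 1) :=
  [set w | exists (x_ : nat -> 'rV[R]_n) (w_ : nat -> 'rV[R]_(n + 1)),
     [/\ forall k, edom g (x_ k),
         enorm (x_ k) @[k --> \oo] --> +oo,
         forall k, limiting_normal (epair (x_ k) (fine (g (x_ k))))
                     (epigraph g) (w_ k)
       & w_ k @[k --> \oo] --> w]].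

Definition subdiff_at_infinity (R : realType) (n : nat)
    (g : 'rV[R]_n -> \bar R) : set 'rV[R]_n :=
  [set u | epi_normal_at_infinity g (epair u (-1))].

Definition singular_subdiff_at_infinity (R : realType) (n : nat)
    (g : 'rV[R]_n -> \bar R) : set 'rV[R]_n :=
  [set u | epi_normal_at_infinity g (epair u 0)].

Definition scale_set (R : realType) (n : nat) (lambda : R)
    (A : set 'rV[R]_n) : set 'rV[R]_n :=
  [set lambda *: u | u in A].

(* Meant for 0 <= lambda. *)
Definition circ_subdiff_at_infinity (R : realType) (n : nat) (lambda : R)
    (g : 'rV[R]_n -> \bar R) : set 'rV[R]_n :=
  if 0 < lambda then scale_set lambda (subdiff_at_infinity g)
  else singular_subdiff_at_infinity g.

Definition lipschitz_at_infinity (R : realType) (n : nat)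
    (g : 'rV[R]_n -> \bar R) : Prop :=
  exists L r : R,
    [/\ 0 < L, 0 < r,
        forall x, r < enorm x -> g x \is a fin_num
      & forall x x', r < enorm x -> r < enorm x' ->
          `|fine (g x) - fine (g x')| <= L * enorm (x - x')].

Definition error_bound_at_infinity (R : realType) (n : nat)
    (g : 'rV[R]_n -> \bar R) : Prop :=
  exists alpha r : R,
    [/\ 0 < alpha, 0 < r
      & forall x, r < enorm x ->
          (edistance x (sublevel0 g) <= alpha%:E * maxe (g x) 0)%E].

(* Main.v *)
Require Import Defs.
From mathcomp Require Import all_boot all_order all_algebra.
From mathcomp Require Import all_classical all_reals all_analysis.
From mathcomp Require Import ring lra.
Import Order.TTheory GRing.Theory Num.Theory.
Import numFieldNormedType.Exports.

(** Let [v] be a Frechet normal to [S = {g <= 0}] at a far point [x]. By the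
    error bound, points near [x] have a point of [S] within about
    [alpha * max(g, 0)], whence
    [dot v (z - x) <= c * max(g z, 0) + e * |z - x|] for [z] near [x], for every
    [c >= alpha * |v|] and [e > 0] ([sublevel_normal_growth]): [v] is a
    subgradient of [c * max(g, 0)] at [x].

    No calculus of limiting normals is needed to extract a normal of the
    epigraph of [g] from this. After replacing the two nonsmooth terms by
    quadratic ones, a smooth function of [(z, b)] is minimized over a compact
    piece of the epigraph. The minimum point [(y, b)] has [y] near [x], and
    minus the gradient there is normal to the epigraph
    ([epigraph_normal_of_penalized_min]). It has the form [(w, - m)] with [w]
    close to [v] and [0 <= m <= 3 * c] ([sublevel_normal_approx]). Possibly
    [b > g y], but a normal above the graph is also one at [(y, g y)].

    For a sequence [x_k] going to infinity with normals tending to [v], the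
    multipliers [m_k] are bounded, so a cluster value [m >= 0] satisfies:
    [(v, - m)] is normal to the epigraph at infinity
    ([sublevel_normal_at_infinity]). If [m > 0], scaling gives
    [v = m *: u] with [u] in the subdifferential at infinity; if [m = 0], [v] is
    in the singular one.

    If [g] is Lipschitz at infinity with constant [L], normals [(w, - m)] at far
    points satisfy [|w| <= L * m], and so do their limits; hence [m = 0] forces
    [v = 0]. To write this [v] as [0 *: u] the subdifferential at infinity must
    be nonempty, which follows from the same minimization applied around far
    points ([lipschitz_subdiff_nonempty]). *)

Set Implicit Arguments.
Unset Strict Implicit.
Unset Printing Implicit Defensive.

Local Open Scope classical_set_scope.
Local Open Scope ring_scope.

(** * Euclidean geometry of row vectors *)

Section Euclidean.
Variables (R : realType) (n : nat).
Implicit Types (u v w x y z : 'rV[R]_n) (a e : R).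

Lemma dotC u v : dot u v = dot v u.
Proof. by apply: eq_bigr => i _; rewrite mulrC. Qed.

Lemma dotDl u v w : dot (u + v) w = dot u w + dot v w.
Proof. by rewrite -big_split; apply: eq_bigr => i _; rewrite mxE mulrDl. Qed.

Lemma dotZl a u v : dot (a *: u) v = a * dot u v.
Proof. by rewrite /dot mulr_sumr; apply: eq_bigr => i _; rewrite mxE mulrA. Qed.

Lemma dotNl u v : dot (- u) v = - dot u v.
Proof. by rewrite -scaleN1r dotZl mulN1r. Qed.

Lemma dotDr u v w : dot u (v + w) = dot u v + dot u w.
Proof. by rewrite dotC dotDl !(dotC u). Qed.

Lemma dotZr a u v : dot u (a *: v) = a * dot u v.
Proof. by rewrite dotC dotZl dotC. Qed.

Lemma dotNr u v : dot u (- v) = - dot u v.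
Proof. by rewrite dotC dotNl dotC. Qed.

Lemma dot0l u : dot 0 u = 0.
Proof. by rewrite -(scale0r 0) dotZl mul0r. Qed.

Lemma dot0r u : dot u 0 = 0.
Proof. by rewrite dotC dot0l. Qed.

Definition dotE := (dotDl, dotDr, dotNl, dotNr, dotZl, dotZr).

Lemma dot_ge0 u : 0 <= dot u u.
Proof. by apply: sumr_ge0 => i _; rewrite -expr2 sqr_ge0. Qed.

Lemma enorm_ge0 u : 0 <= enorm u.
Proof. exact: sqrtr_ge0. Qed.

Lemma enorm_sqr u : enorm u ^+ 2 = dot u u.
Proof. by rewrite sqr_sqrtr ?dot_ge0. Qed.

Lemma enorm0 : enorm (0 : 'rV[R]_n) = 0.
Proof. by rewrite /enorm dot0l sqrtr0. Qed.

Lemma coord_le_enorm u i : `|u 0 i| <= enorm u.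
Proof.
rewrite -(@ler_pXn2r _ 2) ?nnegrE ?normr_ge0 ?enorm_ge0//.
rewrite enorm_sqr real_normK ?num_real// /dot (bigD1 i)//= -expr2 lerDl.
by apply: sumr_ge0 => j _; rewrite -expr2 sqr_ge0.
Qed.

Lemma enorm_eq0 u : enorm u = 0 -> u = 0.
Proof.
move=> u0; apply/rowP => i; apply/eqP; rewrite mxE -normr_le0 -u0.
exact: coord_le_enorm.
Qed.

Lemma enormB_gt0 u v : u != v -> 0 < enorm (u - v).
Proof.
move=> uv; rewrite lt_def enorm_ge0 andbT; apply: contra_neq uv.
by move=> /enorm_eq0/eqP; rewrite subr_eq0 => /eqP.
Qed.

Lemma enormZ a u : enorm (a *: u) = `|a| * enorm u.
Proof. by rewrite /enorm dotZl dotZr mulrA sqrtrM -?expr2 ?sqr_ge0// sqrtr_sqr. Qed.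

Lemma enormN u : enorm (- u) = enorm u.
Proof. by rewrite -scaleN1r enormZ normrN1 mul1r. Qed.

Lemma enormBC u v : enorm (u - v) = enorm (v - u).
Proof. by rewrite -enormN opprB. Qed.

(** Cauchy-Schwarz, from the nonnegative square of
    [enorm v *: u - enorm u *: v]. *)
Lemma dot_le_enorm u v : dot u v <= enorm u * enorm v.
Proof.
have [u0|un0] := eqVneq (enorm u) 0.
  by rewrite u0 mul0r (enorm_eq0 u0) dot0l.
have [v0|vn0] := eqVneq (enorm v) 0.
  by rewrite v0 mulr0 (enorm_eq0 v0) dot0r.
have up : 0 < enorm u by rewrite lt_def un0 enorm_ge0.
have vp : 0 < enorm v by rewrite lt_def vn0 enorm_ge0.
have := dot_ge0 (enorm v *: u - enorm u *: v).
rewrite !dotE -!enorm_sqr (dotC v u) => h.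
have uvp := mulr_gt0 up vp.
rewrite -(ler_pM2l uvp); move: h; nra.
Qed.

Lemma ler_enormD u v : enorm (u + v) <= enorm u + enorm v.
Proof.
rewrite -(@ler_pXn2r _ 2) ?nnegrE ?addr_ge0 ?enorm_ge0//.
rewrite enorm_sqr !dotE -!enorm_sqr (dotC v u).
have := dot_le_enorm u v; nra.
Qed.

Lemma continuous_dot (T : topologicalType) (f g : T -> 'rV[R]_n) :
  continuous f -> continuous g -> continuous (fun t => dot (f t) (g t)).
Proof.
move=> cf cg t; rewrite /dot.
apply: cvg_big => [|i _]; first exact: add_continuous.
by apply: cvgM; apply: (@continuous_comp _ _ _ _ (fun M : 'rV[R]_n => M 0 i));
  [exact: cf|exact: coord_continuous|exact: cg|exact: coord_continuous].
Qed.

Lemma continuous_enorm (T : topologicalType) (f : T -> 'rV[R]_n) :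
  continuous f -> continuous (fun t => enorm (f t)).
Proof.
move=> cf t; apply: (@continuous_comp _ _ _ (fun t => dot (f t) (f t)) Num.sqrt).
  exact: continuous_dot.
exact: sqrt_continuous.
Qed.

(** The ambient topology of row vectors is that of the sup norm; Euclidean
    balls are neighbourhoods in it because [enorm] is continuous, and they form
    a basis because each coordinate is bounded by [enorm]. *)
Lemma nbhs_enormP x (U : set 'rV[R]_n) :
  nbhs x U <-> exists2 e : R, 0 < e & forall z, enorm (z - x) < e -> U z.
Proof.
split=> [/nbhs_ballP[e /= e0 xU]|[e e0 xU]].
  exists e => // z zx; apply: xU; split=> // i j; rewrite ord1.
  apply: le_lt_trans zx; rewrite enormBC.
  by have := coord_le_enorm (x - z) j; rewrite !mxE.
have /(_ x) : continuous (fun z => enorm (z - x)).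
  by apply: continuous_enorm => z; exact: cvgB cvg_id (cvg_cst x).
rewrite /continuous_at subrr enorm0 => /(_ [set t | t < e]).
move=> /(_ (open_nbhs_nbhs (conj (@open_lt _ e) e0))).
exact: filterS xU.
Qed.

Lemma cvg_enormP (u_ : nat -> 'rV[R]_n) v :
  u_ k @[k --> \oo] --> v <->
  forall e, 0 < e -> exists N, forall k, (N <= k)%N -> enorm (u_ k - v) < e.
Proof.
split=> [uv e e0|uv U /nbhs_enormP[e /uv[N uN] eU]].
  have [|N _ uN] := uv [set z | enorm (z - v) < e].
    by apply/nbhs_enormP; exists e.
  by exists N => k /uN.
by exists N => // k Nk; apply: eU; exact: uN.
Qed.

(** A bounded sequence stays in a compact box, hence has a cluster point [v];
    [f k] is the index of a term beyond [k] within [1 / (k + 1)] of [v].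
    The selection [f] need not be monotone: [k <= f k] already lets limits
    along the original sequence pass to the selected terms. *)
Lemma bounded_subsequence (u_ : nat -> 'rV[R]_n) (M : R) :
  (forall k, enorm (u_ k) <= M) ->
  exists (v : 'rV[R]_n) (f : nat -> nat),
    (forall k, (k <= f k)%N) /\ u_ (f k) @[k --> \oo] --> v.
Proof.
move=> uM.
have cB : compact [set v : 'rV[R]_n | forall i, v ord0 i \in `[- M, M]].
  by apply: (@rV_compact _ _ (fun=> `[- M, M]%classic)) => _;
     exact: segment_compact.
have [|v [_ cv]] := cB (u_ @ \oo).
  exists 0%N => // k _ i /=; rewrite in_itv/= -ler_norml.
  exact: le_trans (coord_le_enorm _ _) (uM k).
have near k : exists m, (k <= m)%N /\ enorm (u_ m - v) < k.+1%:R^-1.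
  have kn : (u_ @ \oo) (u_ @` [set m | (k <= m)%N]).
    by exists k => // m km; exists m.
  have kv : nbhs v [set z | enorm (z - v) < k.+1%:R^-1].
    by apply/nbhs_enormP; exists k.+1%:R^-1; rewrite // invr_gt0 ltr0n.
  by have [z [/= [m km <-] zv]] := cv _ _ kn kv; exists m.
have [f fP] := choice near.
exists v, f; split=> [k|]; first by have [] := fP k.
apply/cvg_enormP => e e0.
have [N _ eN] := @near_infty_natSinv_lt R (PosNum e0).
exists N => k Nk; have [_ /lt_trans] := fP k; apply; exact: eN.
Qed.

End Euclidean.

(** * Frechet normals and the epigraph *)

Section FrechetNormals.
Variables (R : realType) (n : nat).
Implicit Types (u v w x y z : 'rV[R]_n) (C : set 'rV[R]_n).

(** The points [z = x], where the difference quotient is [0 / 0], satisfy the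
    inequality trivially, so the puncture of the neighbourhood disappears. *)
Lemma frechet_normalP x C v : frechet_normal x C v <->
  forall e : R, 0 < e -> exists2 d, 0 < d &
    forall z, C z -> enorm (z - x) < d -> dot v (z - x) <= e * enorm (z - x).
Proof.
split=> [vN e e0|vN].
  have : (limf_esup (fun z => (dot v (z - x) / enorm (z - x))%:E)
            (within C x^') < e%:E)%E by apply: le_lt_trans vN _; rewrite lte_fin.
  move=> /ereal_inf_lt[_ [V /nbhs_enormP[d d0 dV] <-]] Ve.
  exists d => // z Cz zd; have [->|zx] := eqVneq z x.
    by rewrite subrr enorm0 mulr0 dot0r.
  rewrite -ler_pdivrMr ?enormB_gt0// -lee_fin; apply: le_trans (ltW Ve).
  by apply: ereal_sup_ubound; exists z => //; exact: dV.
apply/lee_addgt0Pr => e e0; rewrite add0e.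
have [d d0 dN] := vN e e0.
apply: (@le_trans _ _ (ereal_sup
    ((fun z => (dot v (z - x) / enorm (z - x))%:E) @`
     [set z | [/\ C z, z != x & enorm (z - x) < d]]))).
  apply: ereal_inf_lbound; exists [set z | [/\ C z, z != x & enorm (z - x) < d]] => //.
  by apply/nbhs_enormP; exists d.
apply: ge_ereal_sup => _ [z [Cz zx zd] <-]; rewrite lee_fin.
by rewrite ler_pdivrMr ?dN ?enormB_gt0.
Qed.

Lemma frechet_normalZ x C v (a : R) : 0 <= a ->
  frechet_normal x C v -> frechet_normal x C (a *: v).
Proof.
rewrite le_eqVlt => /predU1P[<- _|a0 /frechet_normalP vN];
    apply/frechet_normalP => e e0.
  exists 1 => // z _ _; rewrite scale0r dot0l.
  by rewrite mulr_ge0 ?enorm_ge0 ?ltW.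
have [d d0 dN] := vN _ (divr_gt0 e0 a0).
exists d => // z Cz zd; rewrite dotZl mulrC -ler_pdivlMr//.
by rewrite mulrAC dN.
Qed.

Lemma frechet_limiting_normal x C v : C x ->
  frechet_normal x C v -> limiting_normal x C v.
Proof.
by move=> Cx vN; exists (fun=> x), (fun=> v); split=> //; exact: cvg_cst.
Qed.

End FrechetNormals.

Section EpiPairs.
Variables (R : realType) (n : nat).
Implicit Types (u v w x y z : 'rV[R]_n) (s t : R).

Lemma epairB u v s t : epair u s - epair v t = epair (u - v) (s - t).
Proof.
rewrite /epair opp_row_mx add_row_mx; congr row_mx.
by apply/matrixP => i j; rewrite !mxE.
Qed.

Lemma epairZ a u s : a *: epair u s = epair (a *: u) (a * s).
Proof.
rewrite /epair scale_row_mx; congr row_mx.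
by apply/matrixP => i j; rewrite !mxE.
Qed.

Lemma dot_epair u v s t : dot (epair u s) (epair v t) = dot u v + s * t.
Proof.
rewrite /dot big_split_ord/= big_ord1; congr (_ + _).
  by apply: eq_bigr => i _; rewrite !row_mxEl.
by rewrite !row_mxEr !mxE.
Qed.

Lemma epair_surj (w : 'rV[R]_(n + 1)) : exists u s, w = epair u s.
Proof.
exists (lsubmx w), (rsubmx w 0 0); rewrite -[LHS]hsubmxK; congr row_mx.
by apply/matrixP => i j; rewrite !mxE !ord1.
Qed.

Lemma enorm_epair_sqr u s : enorm (epair u s) ^+ 2 = enorm u ^+ 2 + s ^+ 2.
Proof. by rewrite !enorm_sqr dot_epair expr2. Qed.

Lemma enorm_le_epairl u s : enorm u <= enorm (epair u s).
Proof.
rewrite -(@ler_pXn2r _ 2) ?nnegrE ?enorm_ge0// enorm_epair_sqr lerDl.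
exact: sqr_ge0.
Qed.

Lemma enorm_le_epairr u s : `|s| <= enorm (epair u s).
Proof.
rewrite -(@ler_pXn2r _ 2) ?nnegrE ?enorm_ge0//.
by rewrite enorm_epair_sqr real_normK ?num_real// lerDr sqr_ge0.
Qed.

Lemma enorm_epair_le u s : enorm (epair u s) <= enorm u + `|s|.
Proof.
rewrite -(@ler_pXn2r _ 2) ?nnegrE ?addr_ge0 ?enorm_ge0//.
rewrite enorm_epair_sqr -(@real_normK _ s) ?num_real//.
by have := enorm_ge0 u; have := normr_ge0 s; nra.
Qed.

End EpiPairs.

Section EpigraphNormals.
Variables (R : realType) (n : nat) (g : 'rV[R]_n -> \bar R).
Implicit Types (u v w x y z : 'rV[R]_n).

Lemma epigraphP z (b : R) : epigraph g (epair z b) <-> (g z <= b%:E)%E.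
Proof.
split=> [[z' [b' [gz' /eq_row_mx[-> /matrixP/(_ 0 0)]]]]|gz]; last by exists z, b.
by rewrite !mxE => ->.
Qed.

(** Vertical upward translations map the epigraph into itself, so a local
    inequality around a point [(y, b)] of the epigraph can be moved down to a
    point [(y, a)] with [a <= b]: the competitor near [(y, a)] is raised by
    [b - a] before the inequality is applied. A quadratic error is negligible
    for Frechet normals. *)
Lemma epigraph_normal_of_bound y w (a b m K r : R) :
  0 < r -> a <= b ->
  (forall z b', (g z <= b'%:E)%E -> enorm (z - y) < r -> `|b' - b| < r ->
    dot w (z - y) - m * (b' - b) <= K * (enorm (z - y) ^+ 2 + (b' - b) ^+ 2)) ->
  frechet_normal (epair y a) (epigraph g) (epair w (- m)).
Proof.
move=> r0 ab wK; apply/frechet_normalP => e e0.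
have K0 : 0 < `|K| + 1 by rewrite ltr_wpDl.
exists (Num.min r (e / (`|K| + 1))); first by rewrite lt_min r0 divr_gt0.
move=> _ [z [b' [gz ->]]]; rewrite epairB lt_min => /andP[zr ze].
have := wK z (b' + (b - a)) _ _ _.
rewrite dot_epair mulNr (_ : b' + (b - a) - b = b' - a); last by ring.
rewrite -enorm_epair_sqr => H.
apply: le_trans (H _ _ _) _.
- by apply: le_trans gz _; rewrite lee_fin lerDl subr_ge0.
- exact: le_lt_trans (enorm_le_epairl _ _) zr.
- exact: le_lt_trans (enorm_le_epairr _ _) zr.
rewrite expr2 mulrA ler_wpM2r ?enorm_ge0//.
apply: le_trans (_ : (`|K| + 1) * enorm (epair (z - y) (b' - a)) <= _).
  by rewrite ler_wpM2r ?enorm_ge0// (le_trans (ler_norm _))// lerDl.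
by rewrite mulrC -ler_pdivlMr// ltW.
Qed.

End EpigraphNormals.

(** * Epigraph normals from a penalized minimum *)

Section PenalizedMinimum.
Variables (R : realType) (n : nat) (g : 'rV[R]_n -> \bar R).
Hypothesis g_noninfty : forall x, g x <> -oo%E.
Hypothesis g_lsc : lower_semicontinuous g.
Implicit Types (u v w x y z : 'rV[R]_n).

Lemma closed_epigraph : closed [set p : 'rV[R]_n * R | (g p.1 <= p.2%:E)%E].
Proof.
rewrite -openC openE => -[z b] /= /negP; rewrite -ltNge => bg.
have [s bs sg] : exists2 s : R, b < s & (s%:E < g z)%E.
  case: (g z) bg => [t| |//]; last by exists (b + 1); rewrite ?ltrDl ?ltry.
  by rewrite lte_fin => bt; exists ((b + t) / 2); rewrite ?lte_fin; lra.
have [V zV gV] := g_lsc sg.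
exists (V, [set t | t < s]) => /=.
  by split=> //; apply: open_nbhs_nbhs; split=> //; exact: open_lt.
move=> [z' b'] [/= /gV sg' b's]; apply/negP; rewrite -ltNge.
by apply: lt_trans sg'; rewrite lte_fin.
Qed.

Lemma compact_epigraph_cylinder x (d s t : R) :
  compact [set p : 'rV[R]_n * R |
    [/\ enorm (p.1 - x) <= d, s <= p.2 <= t & (g p.1 <= p.2%:E)%E]].
Proof.
have cbox := @rV_compact _ _ (fun i => `[x ord0 i - d, x ord0 i + d]%classic)
  (fun i => @segment_compact _ _ _).
have cball : closed [set p : 'rV[R]_n * R | enorm (p.1 - x) <= d].
  have cn : continuous (fun p : 'rV[R]_n * R => enorm (p.1 - x)).
    by apply: continuous_enorm => p; exact: cvgB cvg_fst (cvg_cst x).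
  exact: (preimage_closed (fun p _ => cn p) (@closed_le _ d)).
have := compact_closedI (compact_closedI
  (compact_setX cbox (@segment_compact _ s t)) cball) closed_epigraph.
congr compact; apply/seteqP.
split=> [[z b] [[[/= _ sb] zx] gb]|[z b] [/= zx sb gb]] /=.
  by move: sb; rewrite in_itv/= => sb; split.
split=> //; split=> //; split=> //= i; rewrite in_itv/= -ler_distl; apply: le_trans zx.
by have := coord_le_enorm (z - x) i; rewrite !mxE.
Qed.

(** The source of all the normals below. The smooth function
    [K * (b - beta)^2 - dot v (z - x) + A * |z - x|^2] of [(z, b)] has a
    minimum over the part of the epigraph above the closed ball of radius [d]
    and above height [beta]. If its value at [(x, b0)] is smaller than its
    values over the sphere, the minimum point [(y, b)] lies above the open
    ball, and minus the gradient there is normal to the epigraph: first at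
    [(y, b)], then, [b] being at least [g y], at the point [(y, g y)]. *)
Lemma epigraph_normal_of_penalized_min x v (beta b0 K A d : R) :
  0 < K -> 0 <= A -> 0 < d -> (g x <= b0%:E)%E -> beta <= b0 ->
  (forall z b, enorm (z - x) = d -> (g z <= b%:E)%E -> beta <= b ->
    K * (b0 - beta) ^+ 2 <
      K * (b - beta) ^+ 2 - dot v (z - x) + A * d ^+ 2) ->
  exists y (b : R),
    [/\ enorm (y - x) < d, (g y <= b%:E)%E, beta <= b,
        K * (b - beta) ^+ 2 - dot v (y - x) + A * enorm (y - x) ^+ 2 <=
          K * (b0 - beta) ^+ 2
      & frechet_normal (epair y (fine (g y))) (epigraph g)
          (epair (v - (2 * A) *: (y - x)) (- (2 * K * (b - beta))))].
Proof.
move=> K0 A0 d0 gx bb0 Hd.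
pose t := (b0 - beta) ^+ 2 + enorm v * d / K.
have t0 : 0 <= t by rewrite addr_ge0 ?sqr_ge0// divr_ge0 ?mulr_ge0 ?enorm_ge0 ?ltW.
(* At height B the penalty outweighs the value at (x, b0) plus |v| * d, which is
   the most that the linear term can gain. *)
pose B := beta + (t + 1).
pose E := [set p : 'rV[R]_n * R |
    [/\ enorm (p.1 - x) <= d, beta <= p.2 <= B & (g p.1 <= p.2%:E)%E]].
pose H (p : 'rV[R]_n * R) :=
  K * (p.2 - beta) ^+ 2 - dot v (p.1 - x) + A * dot (p.1 - x) (p.1 - x).
have cH : continuous H.
  have c1 : continuous (fun p : 'rV[R]_n * R => p.1 - x).
    by move=> p; exact: cvgB cvg_fst (cvg_cst x).
  move=> p; apply: cvgD; first apply: cvgB.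
  - apply: cvgM; first exact: cvg_cst.
    by apply: cvgM; exact: cvgB cvg_snd (cvg_cst beta).
  - have cv : continuous (fun _ : 'rV[R]_n * R => v) by move=> q; exact: cvg_cst.
    exact: (continuous_dot cv c1).
  - apply: cvgM; first exact: cvg_cst.
    exact: (continuous_dot c1 c1).
have xE : E (x, b0).
  split=> //=; first by rewrite subrr enorm0 ltW.
  rewrite bb0/= /B /t; have : 0 <= enorm v * d / K.
    by rewrite divr_ge0 ?mulr_ge0 ?enorm_ge0 ?ltW.
  by have := sqr_ge0 (b0 - beta - 1); have := sqr_ge0 (b0 - beta); lra.
have [[y b] /set_mem[/= yd /andP[betab bB] gy] ymin] := compact_EVT_min
  (ex_intro _ _ xE) (@compact_epigraph_cylinder x d beta B)
  (continuous_subspaceT cH).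
have {}ymin z b' : enorm (z - x) <= d -> beta <= b' -> b' <= B ->
    (g z <= b'%:E)%E -> H (y, b) <= H (z, b').
  by move=> ? ? ? ?; apply: ymin; apply/mem_set; split=> //=; apply/andP.
have Hyb : K * (b - beta) ^+ 2 - dot v (y - x) + A * enorm (y - x) ^+ 2 <=
          K * (b0 - beta) ^+ 2.
  have := xE; case=> /= ? /andP[? ?] ?.
  rewrite enorm_sqr; apply: le_trans (ymin x b0 _ _ _ _) _ => //.
  by rewrite /H/= subrr !dot0r mulr0 addr0 subr0.
have {}yd : enorm (y - x) < d.
  rewrite lt_neqAle yd andbT; apply/eqP => ydE.
  by have := Hd y b ydE gy betab; rewrite -ydE ltNge Hyb.
have {}bB : b < B.
  rewrite lt_neqAle bB andbT; apply/eqP => bE; move: Hyb.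
  apply/negP; rewrite -ltNge bE (_ : B - beta = t + 1); last by rewrite /B; ring.
  have vd : dot v (y - x) <= enorm v * d.
    by apply: le_trans (dot_le_enorm _ _) _; rewrite ler_wpM2l ?enorm_ge0 ?ltW.
  have Ay : 0 <= A * enorm (y - x) ^+ 2 by rewrite mulr_ge0 ?sqr_ge0.
  have tK : K * t = K * (b0 - beta) ^+ 2 + enorm v * d.
    by rewrite /t mulrDr [K * (_ / K)]mulrC divfK ?gt_eqF.
  have : 0 < K * (t + 1) ^+ 2 - K * t.
    by rewrite -mulrBr mulr_gt0//; nra.
  lra.
have [a ga] : exists a, g y = a%:E.
  by move: gy (@g_noninfty y); case: (g y) => [a _ _|//|//]; exists a.
exists y, b; split=> //; rewrite ga/=.
apply: (@epigraph_normal_of_bound _ _ _ _ _ _ b _ (K + A)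
  (Num.min (d - enorm (y - x)) (B - b))).
- by rewrite lt_min !subr_gt0 yd.
- by rewrite -lee_fin -ga.
move=> z b' gz; rewrite !lt_min => /andP[zd _] /andP[_ b'B].
have zxy : z - x = (z - y) + (y - x) by rewrite addrA subrK.
have zx : enorm (z - x) <= d.
  by rewrite zxy; apply: le_trans (ler_enormD _ _) _; rewrite -lerBrDr ltW.
have b'B' : b' <= B by have := ler_norm (b' - b); lra.
(* A competitor below height beta is raised to beta. This is harmless, because
   max(s - beta, 0)^2 is at most
   (b - beta)^2 + 2 (b - beta) (s - b) + (s - b)^2. *)
have := ymin z (Num.max b' beta) zx.
rewrite le_max lexx orbT ge_max b'B' (le_trans betab (ltW bB)).
move=> /(_ isT isT); rewrite -lee_fin.
have -> : (g z <= (Num.max b' beta)%:E)%E.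
  by apply: le_trans gz _; rewrite lee_fin le_max lexx.
move=> /(_ isT); rewrite lee_fin /H/= zxy -!enorm_sqr.
have sq : (Num.max b' beta - beta) ^+ 2 <=
    (b - beta) ^+ 2 + 2 * (b - beta) * (b' - b) + (b' - b) ^+ 2.
  by case: (leP b' beta) => _; have := sqr_ge0 (b' - beta); lra.
have {}sq := ler_wpM2l (ltW K0) sq.
have K1 : 0 <= K * enorm (z - y) ^+ 2 by rewrite mulr_ge0 ?sqr_ge0 ?ltW.
have A1 : 0 <= A * (b' - b) ^+ 2 by rewrite mulr_ge0 ?sqr_ge0.
rewrite !enorm_sqr in K1 *; rewrite !dotE !(dotC y) !(dotC x) in K1 *.
lra.
Qed.

End PenalizedMinimum.

(** * Normals to the sublevel set under an error bound *)

Section ErrorBound.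
Variables (R : realType) (n : nat) (g : 'rV[R]_n -> \bar R).
Implicit Types (u v w x y z : 'rV[R]_n).

(** For every [z] near [x] the error bound provides a point [p] of the sublevel
    set with [|p - z|] only slightly above [alpha * b]. Splitting [z - x] at
    [p], the part [z - p] is controlled by Cauchy-Schwarz, and the part [p - x]
    by normality of [v]. *)
Lemma sublevel_normal_growth (alpha r : R) x v (e : R) :
  0 < alpha ->
  (forall z, r < enorm z ->
     (edistance z (sublevel0 g) <= alpha%:E * maxe (g z) 0)%E) ->
  sublevel0 g x -> r < enorm x -> frechet_normal x (sublevel0 g) v -> 0 < e ->
  exists d : R, [/\ 0 < d, d <= 1 &
    forall z (b : R), enorm (z - x) <= d -> (g z <= b%:E)%E -> 0 <= b ->
      dot v (z - x) <= enorm v * (alpha * b) + e * enorm (z - x)].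
Proof.
move=> alpha0 eb Sx rx /frechet_normalP vN e0.
have e30 : 0 < e / 3 by rewrite divr_gt0.
have [d0 d00 dN] := vN _ e30.
exists (Num.min (Num.min 1 (d0 / 3)) ((enorm x - r) / 2)); split.
- by rewrite !lt_min ltr01 !divr_gt0// subr_gt0.
- by rewrite !ge_min lexx.
move=> z b; rewrite !le_min => /andP[/andP[_ zd] zr] gb b0.
have v0 := enorm_ge0 v.
(* If alpha * b >= |z - x|, the point x itself serves as p. *)
have [ab|ab] := leP (enorm (z - x)) (alpha * b).
  apply: le_trans (dot_le_enorm _ _) _; apply: ler_wpDr.
    by rewrite mulr_ge0 ?enorm_ge0// ltW.
  by rewrite ler_wpM2l.
have N0 : 0 < enorm (z - x) by apply: le_lt_trans ab; rewrite mulr_ge0// ltW.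
(* The first bound on the slack tau keeps p within 2 |z - x| of x, the second
   makes its contribution at most e / 3 * |z - x|. *)
pose tau := Num.min (enorm (z - x) - alpha * b)
                    (e / 3 * enorm (z - x) / (enorm v + 1)).
have v1 : 0 < enorm v + 1 by rewrite ltr_wpDl.
have tau0 : 0 < tau by rewrite lt_min subr_gt0 ab divr_gt0// mulr_gt0.
have rz : r < enorm z.
  have := ler_enormD (x - z) z; rewrite subrK enormBC; lra.
have /ereal_inf_lt[_ [p Sp <-]] :
    (edistance z (sublevel0 g) < (alpha * b + tau)%:E)%E.
  apply: le_lt_trans (eb _ rz) _.
  apply: (@le_lt_trans _ _ (alpha * b)%:E); last by rewrite lte_fin ltrDl.
  rewrite EFinM; apply: lee_wpmul2l; first by rewrite lee_fin ltW.
  by rewrite ge_max gb lee_fin.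
rewrite lte_fin => pz.
have tau1 : tau <= enorm (z - x) - alpha * b by rewrite ge_min lexx.
have tau2 : enorm v * tau <= e / 3 * enorm (z - x).
  have : tau <= e / 3 * enorm (z - x) / (enorm v + 1).
    by rewrite ge_min lexx orbT.
  rewrite ler_pdivlMr// => /(le_trans _); apply.
  by rewrite mulrC ler_wpM2l ?lerDl// ltW.
have zpx : z - x = (z - p) + (p - x) by rewrite addrA subrK.
have px : enorm (p - x) <= 2 * enorm (z - x).
  have := ler_enormD (p - z) (z - x); rewrite addrA subrK; lra.
have := dN p Sp; have -> : enorm (p - x) < d0 by lra.
move=> /(_ isT) vpx.
have vzp : dot v (z - p) <= enorm v * (alpha * b + tau).
  by apply: le_trans (dot_le_enorm _ _) _; rewrite ler_wpM2l// enormBC ltW.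
rewrite zpx dotDr -zpx.
have := ler_wpM2l (ltW e30) px; move: vzp; rewrite mulrDr; lra.
Qed.

Hypothesis g_noninfty : forall x, g x <> -oo%E.
Hypothesis g_lsc : lower_semicontinuous g.

(** The hypothesis says that [v] is an approximate subgradient of the nonsmooth
    function [c * max(g, 0)] at [x]. Smooth penalties replace it: by the
    inequality between arithmetic and geometric means, [c * b] is at most
    [K * b^2 + e * d / 2] for [K = c^2 / (2 e d)], and [e * |z - x|] is
    dominated on the sphere of radius [d] by [(2 e / d) * |z - x|^2]. The
    multiplier [m = 2 K b] stays below [3 c] uniformly in [d] and [e]. *)
Lemma sublevel_normal_approx x v (c d e : R) :
  0 < c -> 0 < d -> 0 < e -> (g x <= 0)%E ->
  (forall z (b : R), enorm (z - x) <= d -> (g z <= b%:E)%E -> 0 <= b ->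
      dot v (z - x) <= c * b + e * enorm (z - x)) ->
  exists y w (m : R),
    [/\ enorm (y - x) < d, edom g y, enorm (w - v) <= 4 * e, 0 <= m <= 3 * c
      & frechet_normal (epair y (fine (g y))) (epigraph g) (epair w (- m))].
Proof.
move=> c0 d0 e0 gx Hv.
have h0 : 0 < e * d by rewrite mulr_gt0.
pose K := c ^+ 2 / (2 * (e * d)); pose A := 2 * e / d.
have K0 : 0 < K by rewrite divr_gt0 ?exprn_gt0 ?mulr_gt0.
have A0 : 0 < A by rewrite divr_gt0 ?mulr_gt0.
have KE (b : R) : K * b ^+ 2 * (2 * (e * d)) = (c * b) ^+ 2.
  by rewrite /K; field; rewrite !gt_eqF.
have AE : A * d ^+ 2 = 2 * (e * d).
  by rewrite /A; field; rewrite gt_eqF.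
have [|y [b [yd gy b0 Hyb yN]]] := @epigraph_normal_of_penalized_min _ _ _
    g_noninfty g_lsc x v 0 0 K A d K0 (ltW A0) d0 gx (lexx 0).
  move=> z b zd gz b0; have := Hv z b _ gz b0; rewrite zd => /(_ (lexx _)).
  rewrite subrr subr0 AE expr0n/= mulr0 => vz.
  suff : 0 < K * b ^+ 2 - c * b + e * d by lra.
  rewrite -(pmulr_lgt0 _ (mulr_gt0 (ltr0n _ 2) h0)) mulrDl mulrBl KE.
  have := sqr_ge0 (c * b - e * d); have := exprn_gt0 2 h0; lra.
exists y, (v - (2 * A) *: (y - x)), (2 * K * (b - 0)); split=> //.
- exact: le_lt_trans gy (ltry _).
- rewrite addrAC subrr add0r enormN enormZ.
  rewrite ger0_norm; last by rewrite mulr_ge0// ltW.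
  have := ler_wpM2l (ltW A0) (ltW yd).
  rewrite (_ : A * d = 2 * e); last by rewrite /A; field; rewrite gt_eqF.
  lra.
rewrite subr0 in Hyb *; apply/andP; split.
  by rewrite mulr_ge0// mulr_ge0// ltW.
have vy := Hv y b (ltW yd) gy b0.
have ey := ler_wpM2l (ltW e0) (ltW yd).
have Ay : 0 <= A * enorm (y - x) ^+ 2 by rewrite mulr_ge0 ?sqr_ge0 ?ltW.
have qh : K * b ^+ 2 <= c * b + e * d.
  by move: Hyb; rewrite subrr expr0n/= mulr0; lra.
have {}qh : c * b <= 3 * (e * d).
  rewrite leNgt; apply/negP => qh'.
  have := ler_wpM2r (ltW (mulr_gt0 (ltr0n R 2) h0)) qh.
  by rewrite KE; apply/negP; rewrite -ltNge; nra.
have -> : 2 * K * b = c * ((c * b) / (e * d)).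
  by rewrite /K; field; rewrite !gt_eqF.
by rewrite mulrC ler_wpM2r ?(ltW c0)// ler_pdivrMr.
Qed.

End ErrorBound.

(** * Normals at infinity *)

Section NormalsAtInfinity.
Variables (R : realType) (n : nat) (g : 'rV[R]_n -> \bar R).
Hypothesis g_noninfty : forall x, g x <> -oo%E.
Implicit Types (u v w x y z : 'rV[R]_n).

Lemma edom_fineK y : edom g y -> (fine (g y))%:E = g y.
Proof.
by move: (@g_noninfty y); rewrite /edom/=; case: (g y).
Qed.

Lemma epi_normal_at_infinityZ (a : R) (p : 'rV[R]_(n + 1)) : 0 <= a ->
  epi_normal_at_infinity g p -> epi_normal_at_infinity g (a *: p).
Proof.
move=> a0 [x_ [w_ [xd xoo wN wp]]].
exists x_, (fun k => a *: w_ k); split=> // [k|]; last exact: cvgZl_tmp wp.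
have [z_ [v_ [zE zx vN vw]]] := wN k.
exists z_, (fun j => a *: v_ j); split=> // [j|]; first exact: frechet_normalZ.
exact: cvgZl_tmp vw.
Qed.

(** Bounded sequences of normals along far points do have limits in the cone at
    infinity; this is where compactness of bounded sets of normals enters. *)
Lemma epi_normal_at_infinity_cluster (y_ : nat -> 'rV[R]_n)
    (p_ : nat -> 'rV[R]_(n + 1)) (M : R) :
  (forall k, edom g (y_ k)) -> (forall k, k%:R <= enorm (y_ k)) ->
  (forall k, frechet_normal (epair (y_ k) (fine (g (y_ k)))) (epigraph g) (p_ k)) ->
  (forall k, enorm (p_ k) <= M) ->
  exists (p : 'rV[R]_(n + 1)) (f : nat -> nat),
    [/\ forall k, (k <= f k)%N, p_ (f k) @[k --> \oo] --> p
      & epi_normal_at_infinity g p].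
Proof.
move=> yd yoo pN pM; have [p [f [fk fp]]] := bounded_subsequence pM.
exists p, f; split=> //; exists (y_ \o f), (p_ \o f); split=> //= [|k].
  apply/cvgryPge => B; near=> k.
  apply: le_trans (_ : (f k)%:R <= _) => //.
  apply: le_trans (_ : k%:R <= _); last by rewrite ler_nat.
  by near: k; exact: nbhs_infty_ger.
apply: frechet_limiting_normal => //.
by apply/epigraphP; rewrite edom_fineK.
Unshelve. all: by end_near. Qed.

Lemma enorm_far_perturb (r e : R) x y :
  r + e <= enorm x -> enorm (y - x) <= e -> r <= enorm y.
Proof.
by move=> rx yx; have := ler_enormD (x - y) y; rewrite subrK enormBC; lra.
Qed.

(** A normal to the sublevel set at a far point [x_ j] is approximated by the
    horizontal part of an epigraph normal at a point within distance 1 of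
    [x_ j]. The multipliers are bounded, since [c] depends only on the error
    bound and on [v]; their limit is [m]. *)
Lemma sublevel_normal_at_infinity v :
  lower_semicontinuous g -> error_bound_at_infinity g ->
  normal_at_infinity (sublevel0 g) v ->
  exists2 m : R, 0 <= m & epi_normal_at_infinity g (epair v (- m)).
Proof.
move=> g_lsc [alpha [r [alpha0 r0 eb]]] [x_ [v_ [xS /cvgryPge xoo vN /cvg_enormP vv]]].
pose c := alpha * (enorm v + 2).
have c0 : 0 < c by rewrite mulr_gt0// ltr_wpDl ?enorm_ge0.
have approx (k : nat) : exists t : 'rV[R]_n * 'rV[R]_n * R,
    [/\ k%:R <= enorm t.1.1, edom g t.1.1, enorm (t.1.2 - v) <= k.+1%:R^-1,
        0 <= t.2 <= 3 * c &
        frechet_normal (epair t.1.1 (fine (g t.1.1))) (epigraph g)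
          (epair t.1.2 (- t.2))].
  have : k.+1%:R^-1 <= 1 :> R by rewrite invf_le1 ?ltr0n// ler1n.
  have : 0 < k.+1%:R^-1 :> R by rewrite invr_gt0 ltr0n.
  move: (k.+1%:R^-1) => e e0 e1.
  have [N1 vN1] := vv _ (divr_gt0 e0 (ltr0n R 2)).
  have [N2 _ xN2] := xoo (r + k%:R + 2).
  pose j := maxn N1 N2.
  have {}vN1 := vN1 j (leq_maxl _ _).
  have {}xN2 := xN2 j (leq_maxr _ _).
  rewrite /= in xN2.
  have k0 : 0 <= k%:R :> R by [].
  have rx : r < enorm (x_ j) by lra.
  have e80 : 0 < e / 8 :> R by rewrite divr_gt0.
  have [d [d0 d1 dg]] := sublevel_normal_growth alpha0 eb (xS j) rx (vN j) e80.
  have vjv : enorm (v_ j) <= enorm v + 2.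
    have := ler_enormD (v_ j - v) v; rewrite subrK; lra.
  have [|y [w [m [yd yg wv mc yN]]]] :=
      @sublevel_normal_approx _ _ _ g_noninfty g_lsc _ (v_ j) _ _ _ c0 d0 e80 (xS j).
    move=> z b zd gz b0; apply: le_trans (dg z b zd gz b0) _; rewrite lerD2r.
    rewrite /c mulrC -!mulrA ler_wpM2l ?(ltW alpha0)// mulrC ler_wpM2r//.
  exists (y, w, m); split=> //=.
    by apply: (@enorm_far_perturb _ 1 (x_ j)); lra.
  by have := ler_enormD (w - v_ j) (v_ j - v); rewrite addrA subrK; lra.
have [t tP] := choice approx.
have [||||p [f [fk /cvg_enormP fp pN]]] := @epi_normal_at_infinity_cluster (fun k => (t k).1.1)
  (fun k => epair (t k).1.2 (- (t k).2)) (enorm v + 1 + 3 * c).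
- by move=> k; have [] := tP k.
- by move=> k; have [] := tP k.
- by move=> k; have [] := tP k.
- move=> k; have [_ _ wv /andP[m0 mc] _] := tP k.
  apply: le_trans (enorm_epair_le _ _) _; rewrite normrN ger0_norm// lerD//.
  have e1 : k.+1%:R^-1 <= 1 :> R by rewrite invf_le1 ?ltr0n// ler1n.
  have := ler_enormD ((t k).1.2 - v) v.
  by rewrite subrK; have := le_trans wv e1; lra.
have [u [s pE]] := epair_surj p.
have tp (e : R) : 0 < e ->
    exists2 k, enorm ((t k).1.2 - v) < e &
      enorm ((t k).1.2 - u) < e /\ `|- (t k).2 - s| < e.
  move=> e0; have [N1 fpN] := fp _ e0.
  have [N2 _ eN2] := @near_infty_natSinv_lt R (PosNum e0).
  pose k := maxn N1 N2.
  have := fpN k (leq_maxl _ _); rewrite pE epairB => tk.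
  exists (f k).
    have [_ _ tv _ _] := tP (f k); apply: le_lt_trans tv _.
    by apply: eN2 => /=; exact: leq_trans (leq_maxr _ _) (fk k).
  split; first exact: le_lt_trans (enorm_le_epairl _ _) tk.
  exact: le_lt_trans (enorm_le_epairr _ _) tk.
have s0 : s <= 0.
  apply/ler_addgt0Pr => e e0; rewrite add0r.
  have [k _ [_ ts]] := tp _ e0; have [_ _ _ /andP[t0 _] _] := tP k.
  by move: ts; rewrite ltr_norml => /andP[+ _]; lra.
have uv : u = v.
  apply/eqP; rewrite -subr_eq0; apply/eqP/enorm_eq0/eqP.
  rewrite eq_le enorm_ge0 andbT; apply/ler_addgt0Pr => e e0; rewrite add0r.
  have [k tv [tu _]] := tp _ (divr_gt0 e0 (ltr0n R 2)).
  have := ler_enormD (u - (t k).1.2) ((t k).1.2 - v).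
  by rewrite addrA subrK (enormBC u); lra.
by exists (- s); rewrite ?oppr_ge0// opprK -uv -pE.
Qed.

Lemma lipschitz_cone_closed (L : R) v (s : R) (p_ : nat -> 'rV[R]_(n + 1)) :
  0 <= L -> p_ k @[k --> \oo] --> epair v s ->
  (exists N, forall k, (N <= k)%N ->
     exists w m, p_ k = epair w m /\ enorm w <= - (L * m)) ->
  enorm v <= - (L * s).
Proof.
move=> L0 /cvg_enormP pv [N pN]; apply/ler_addgt0Pr => e e0.
have L1 : 0 < L + 1 by rewrite ltr_wpDl.
have [q q0 qE] : exists2 q, 0 < q & q * (L + 1) = e.
  by exists (e / (L + 1)); rewrite ?divr_gt0// divfK// gt_eqF.
have [N' pN'] := pv _ q0.
have [w [m [pE wm]]] := pN _ (leq_maxl N N').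
have := pN' _ (leq_maxr N N'); rewrite pE epairB => wv.
have wv1 := le_lt_trans (enorm_le_epairl _ _) wv.
have /ltW := le_lt_trans (enorm_le_epairr _ _) wv.
rewrite ler_norml => /andP[ms _].
have := ler_enormD (v - w) w; rewrite subrK enormBC.
by have := ler_wpM2l L0 ms; lra.
Qed.

(** * Functions that are Lipschitz at infinity *)

Section LipschitzAtInfinity.
Variables (L r : R).
Hypothesis L0 : 0 < L.
Hypothesis g_fin : forall x, r < enorm x -> g x \is a fin_num.
Hypothesis g_lip : forall x x', r < enorm x -> r < enorm x' ->
  `|fine (g x) - fine (g x')| <= L * enorm (x - x').

(** By the Lipschitz estimate, a far point of the epigraph can be moved in the
    direction [(u, tau)] without leaving the epigraph, so no normal makes an
    acute angle with it. *)
Lemma lipschitz_normal_polar y u w (b tau s : R) :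
  r < enorm y -> (g y <= b%:E)%E -> L * enorm u <= tau ->
  frechet_normal (epair y b) (epigraph g) (epair w s) ->
  dot w u + s * tau <= 0.
Proof.
move=> ry gy utau /frechet_normalP wN; apply/ler_addgt0Pr => e e0; rewrite add0r.
have u0 := enorm_ge0 u.
have tau0 : 0 <= tau by apply: le_trans utau; rewrite mulr_ge0// ltW.
have D0 : 0 < enorm u + tau + 1 by lra.
have [d d0 dN] := wN _ (divr_gt0 e0 D0).
have m0 : 0 < Num.min d (enorm y - r) by rewrite lt_min d0 subr_gt0.
have [t t0 tD] : exists2 t, 0 < t &
    t * (enorm u + tau + 1) < Num.min d (enorm y - r).
  exists (Num.min d (enorm y - r) / (enorm u + tau + 1) / 2).
    by rewrite !divr_gt0.
  by rewrite mulrAC divfK ?gt_eqF//; lra.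
have tu0 : 0 <= t * enorm u by rewrite mulr_ge0// ltW.
have ttau0 : 0 <= t * tau by rewrite mulr_ge0// ltW.
move: tD; rewrite lt_min !mulrDr mulr1 => /andP[td tr].
have ryt : r < enorm (y + t *: u).
  have := ler_enormD (y + t *: u) (- (t *: u)).
  rewrite addrK enormN enormZ (gtr0_norm t0); lra.
have gyt : (g (y + t *: u) <= (b + t * tau)%:E)%E.
  rewrite -(fineK (g_fin ryt)) lee_fin.
  have gyb : fine (g y) <= b by rewrite -lee_fin fineK// g_fin.
  have := g_lip ryt ry; rewrite addrAC subrr add0r enormZ (gtr0_norm t0).
  move=> /(le_trans (ler_norm _)); have := ler_wpM2l (ltW t0) utau; lra.
have := dN (epair (y + t *: u) (b + t * tau)); rewrite epairB.
rewrite (addrAC y) subrr add0r (addrAC b) subrr add0r dot_epair dotZr.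
have N1 := enorm_epair_le (t *: u) (t * tau).
rewrite enormZ (gtr0_norm t0) (ger0_norm ttau0) in N1.
have -> : enorm (epair (t *: u) (t * tau)) < d by lra.
move=> /(_ (iffRL (epigraphP _ _ _) gyt) isT) H.
rewrite -(ler_pM2l t0) mulrDr (mulrCA t s); apply: le_trans H _.
apply: le_trans (ler_wpM2l (ltW (divr_gt0 e0 D0)) N1) _.
by rewrite mulrAC ler_pdivrMr// (mulrC t e) -mulrA ler_wpM2l ?(ltW e0)//; lra.
Qed.

(** The direction [(0, 1)] gives [s <= 0], and [(w, L * |w|)] gives the bound. *)
Lemma lipschitz_frechet_normal y w (b s : R) :
  r < enorm y -> (g y <= b%:E)%E ->
  frechet_normal (epair y b) (epigraph g) (epair w s) ->
  enorm w <= - (L * s).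
Proof.
move=> ry gy wN.
have s0 : s <= 0.
  have := lipschitz_normal_polar (u := 0) (tau := 1) ry gy _ wN.
  rewrite enorm0 mulr0 ler01 mulr1 dot0r add0r.
  exact.
have := lipschitz_normal_polar ry gy (lexx (L * enorm w)) wN.
rewrite -enorm_sqr => H; rewrite leNgt; apply/negP => Lsw.
have w0 := enorm_ge0 w; have Ls : L * s <= 0 by rewrite mulr_ge0_le0// ltW.
nra.
Qed.

(** The bound survives both limits: from Frechet to limiting normals, and along
    the sequence of base points. *)
Lemma lipschitz_epi_normal_at_infinity v (s : R) :
  epi_normal_at_infinity g (epair v s) -> enorm v <= - (L * s).
Proof.
move=> [x_ [p_ [xd /cvgryPge xoo pN pv]]].
apply: (lipschitz_cone_closed (ltW L0) pv).
have [N _ xN] := xoo (r + 1); exists N => k /xN /= rx.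
have [z_ [v_ [zE /cvg_enormP zx vN vp]]] := pN k.
have [w [m pE]] := epair_surj (p_ k); exists w, m; split=> //.
rewrite pE in vp; apply: (lipschitz_cone_closed (ltW L0) vp).
have [N' zN'] := zx _ ltr01; exists N' => j /zN'.
have [y [b [gy zyb]]] := zE j; have [u [t vE]] := epair_surj (v_ j).
move=> zj; exists u, t; split=> //.
have := vN j; rewrite vE zyb; apply: lipschitz_frechet_normal gy.
rewrite zyb epairB in zj.
have := le_lt_trans (enorm_le_epairl _ _) zj.
have := ler_enormD (x_ k - y) y; rewrite subrK enormBC; lra.
Qed.

(** Around a far point [x], the quadratic penalty at height [g x - 1] is used
    with [v = 0]. Over the ball of radius [d < 1 / (2 L)] the values of [g]
    exceed [g x - 1 / 2], so the vertical component of the resulting normal is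
    at most [- 1], and the normal can be rescaled to end in [- 1]. The
    horizontal parts are bounded by [2 A d], with [A] and [d] depending only on
    [L]. *)
Lemma lipschitz_subdiff_nonempty :
  lower_semicontinuous g -> (forall N : R, exists x : 'rV[R]_n, N <= enorm x) ->
  subdiff_at_infinity g !=set0.
Proof.
move=> g_lsc unbounded.
pose d := (2 * (L + 1))^-1.
have L1 : 0 < 2 * (L + 1) by rewrite mulr_gt0// ltr_wpDl// ltW.
have d0 : 0 < d by rewrite invr_gt0.
have Ld : L * d + d = 2^-1.
  by rewrite /d; field; rewrite gt_eqF// ltr_wpDl// ltW.
have Ld0 : 0 < L * d by rewrite mulr_gt0.
pose A := (d ^+ 2)^-1.
have A0 : 0 < A by rewrite invr_gt0 exprn_gt0.
have AE : A * d ^+ 2 = 1 by rewrite mulVf// gt_eqF// exprn_gt0.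
have approx (k : nat) : exists t : 'rV[R]_n * 'rV[R]_n,
    [/\ k%:R <= enorm t.1, edom g t.1, enorm t.2 <= 2 * A * d &
        frechet_normal (epair t.1 (fine (g t.1))) (epigraph g)
          (epair t.2 (- 1))].
  have [x rx] := unbounded (Num.max r k%:R + 1).
  have rr : r <= Num.max r k%:R by rewrite le_max lexx.
  have rk : k%:R <= Num.max r k%:R by rewrite le_max lexx orbT.
  have gx := fineK (g_fin (_ : r < enorm x)).
  have far z : enorm (z - x) <= d -> r < enorm z.
    by move=> zx; have := ler_enormD (x - z) z; rewrite subrK enormBC; lra.
  have gz z b : enorm (z - x) <= d -> (g z <= b%:E)%E ->
      2^-1 <= b - (fine (g x) - 1).
    move=> zx gzb; have rz := far z zx.
    have : fine (g z) <= b by rewrite -lee_fin fineK// g_fin.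
    have := g_lip (far x _) rz; rewrite subrr enorm0 => /(_ (ltW d0)).
    move=> /(le_trans (ler_norm _)); rewrite enormBC.
    by have := ler_wpM2l (ltW L0) zx; lra.
  have [|||y [b [yd gyb _ Hyb yN]]] := @epigraph_normal_of_penalized_min _ _ _
    g_noninfty g_lsc x 0 (fine (g x) - 1) (fine (g x)) 1 A d ltr01 (ltW A0) d0.
  - by rewrite gx//; lra.
  - by rewrite gerBl.
  - move=> z b zx gzb _; rewrite dot0l subr0 AE.
    by have := gz z b _ gzb; rewrite zx => /(_ (lexx _)); nra.
  have gyb' := gz _ _ (ltW yd) gyb.
  have m0 : 1 <= 2 * 1 * (b - (fine (g x) - 1)) by lra.
  move: (2 * 1 * (b - (fine (g x) - 1))) m0 yN => m m0 yN.
  have mp : 0 < m by lra.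
  exists (y, m^-1 *: (0 - (2 * A) *: (y - x))); split=> //=.
  - by apply: (@enorm_far_perturb _ d x); lra.
  - exact: le_lt_trans gyb (ltry _).
  - rewrite sub0r enormZ enormN enormZ !ger0_norm ?invr_ge0 ?mulr_ge0 ?(ltW mp) ?(ltW A0)//.
    have : m^-1 <= 1 by rewrite invf_le1.
    rewrite -(mul1r (2 * A * d)) => m1; apply: ler_pM => //.
    + by rewrite invr_ge0 ltW.
    + by rewrite !mulr_ge0 ?enorm_ge0// ltW.
    + by rewrite ler_wpM2l ?(ltW yd)// mulr_ge0// ltW.
  - have mi : 0 <= m^-1 by rewrite invr_ge0 ltW.
    by have := frechet_normalZ mi yN; rewrite epairZ mulrN mulVf ?gt_eqF.
have [t tP] := choice approx.
have [||||p [f [fk fp pN]]] := @epi_normal_at_infinity_cluster (fun k => (t k).1)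
  (fun k => epair (t k).2 (- 1)) (2 * A * d + 1).
- by move=> k; have [] := tP k.
- by move=> k; have [] := tP k.
- by move=> k; have [] := tP k.
- move=> k; have [_ _ tA _] := tP k.
  by apply: le_trans (enorm_epair_le _ _) _; rewrite normrN normr1 lerD2r.
have [u [s pE]] := epair_surj p.
suff s1 : s = - 1 by exists u; rewrite /subdiff_at_infinity/= -s1 -pE.
apply/eqP; rewrite -subr_eq0 -normr_le0; apply/ler_addgt0Pr => e e0.
have /cvg_enormP/(_ _ e0)[N fN] := fp.
have := fN N (leqnn _); rewrite pE epairB => /ltW/(le_trans (enorm_le_epairr _ _)).
by rewrite add0r distrC.
Qed.

End LipschitzAtInfinity.
End NormalsAtInfinity.

(** * The two inclusions *)

Theorem proposition4p2 (R : realType) (n : nat) (g : 'rV[R]_n -> \bar R)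
    (g_noninfty : forall x, g x <> -oo%E)
    (g_lsc : lower_semicontinuous g)
    (g_eb : error_bound_at_infinity g) :
  normal_at_infinity (sublevel0 g) `<=`
    \bigcup_(lambda in [set l : R | 0 <= l]) circ_subdiff_at_infinity lambda g
  /\
  (lipschitz_at_infinity g ->
   normal_at_infinity (sublevel0 g) `<=`
     \bigcup_(lambda in [set l : R | 0 <= l])
       scale_set lambda (subdiff_at_infinity g)).
Proof.
have scaled (v : 'rV[R]_n) (m : R) : 0 < m -> epi_normal_at_infinity g (epair v (- m)) ->
    scale_set m (subdiff_at_infinity g) v.
  move=> m0 vN; exists (m^-1 *: v); last by rewrite scalerA mulfV ?gt_eqF// scale1r.
  rewrite /subdiff_at_infinity/= (_ : - 1 = m^-1 * - m) -?epairZ.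
    by apply: epi_normal_at_infinityZ => //; rewrite invr_ge0 ltW.
  by rewrite mulrN mulVf// gt_eqF.
split=> [v vN|[L [r [L0 r0 g_fin g_lip]]] v vN].
  have [m m0 {}vN] := sublevel_normal_at_infinity g_noninfty g_lsc g_eb vN.
  exists m => //; rewrite /circ_subdiff_at_infinity; case: ltP => [m1|m1].
    exact: scaled.
  by rewrite /singular_subdiff_at_infinity/= -oppr0 -(le_anti (introT andP (conj m1 m0))).
have unbounded (N : R) : exists x : 'rV[R]_n, N <= enorm x.
  have [x_ [_ [_ /cvgryPge/(_ N)[k _ xk] _ _]]] := vN.
  by exists (x_ k); exact: (xk k (leqnn k)).
have [m m0 {}vN] := sublevel_normal_at_infinity g_noninfty g_lsc g_eb vN.
exists m => //; have [m1|m1] := ltP 0 m; first exact: scaled.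
have {m1} mE : m = 0 by apply/eqP; rewrite eq_le m1.
(* For m = 0 the normal (v, 0) forces v = 0, which is 0 times any subgradient. *)
have [u uN] := lipschitz_subdiff_nonempty g_noninfty L0 g_fin g_lip g_lsc unbounded.
exists u => //; rewrite mE scale0r; apply/esym/enorm_eq0/eqP.
rewrite eq_le enorm_ge0 andbT.
have := lipschitz_epi_normal_at_infinity L0 g_fin g_lip vN.
by rewrite mE oppr0 mulr0 oppr0.
Qed.
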